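(* For every $N\in\mathbb{N}$ and every symmetric shuffle $S_\pi$ with $N$ stripes (i.e. $\pi$ is a permutation of $\{1,\dots,N\}$ with $\pi\circ\pi=\mathrm{id}$) the inequality $$\rho(S_\pi)\le 1-\frac{2}{3}\bigl(1-\phi(S_\pi)\bigr)^2$$ holds. Furthermore, equality holds in this inequality if, and only if, the map $i\mapsto \pi(i)-i$ is constant on $I_\pi^-$ and $\#I_\pi^-=\frac{N}{2}$ holds.
   Context: $\lambda$ denotes Lebesgue measure on $[0,1]$. For a permutation $\pi$ of $\{1,\dots,N\}$, the equidistant even shuffle $S_\pi:[0,1]\to[0,1]$ with $N$ stripes is the $\lambda$-preserving map given by $S_\pi(x)=x-\frac{i-\pi(i)}{N}$ for $x\in I_N^i:=(\frac{i-1}{N},\frac{i}{N})$, $i=1,\dots,N$ (values at the finitely many grid points are irrelevant). Its copula is $C_{S_\pi}(u,v)=\lambda(\{x\in[0,u]: S_\pi(x)\le v\})$. The shuffle is called symmetric iff $C_{S_\pi}(u,v)=C_{S_\pi}(v,u)$ for all $u,v\in[0,1]$, equivalently iff $\pi\circ\pi=\mathrm{id}$. Put $I_\pi^-:=\{i\in\{1,\dots,N\}:\pi(i)<i\}$; $\#$ denotes cardinality. For a bivariate copula $C$, Spearman's rho and Spearman's footrule are $$\rho(C)=12\int_{[0,1]^2}C(u,v)\,d\lambda_2(u,v)-3,\qquad \phi(C)=6\int_{[0,1]}C(u,u)\,d\lambda(u)-2,$$ where $\lambda_2$ is two-dimensional Lebesgue measure, and $\rho(S_\pi):=\rho(C_{S_\pi})$,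 $\phi(S_\pi):=\phi(C_{S_\pi})$.
   Formalization: The equality criterion is corrected to ''π = id, or the stated condition'': for π = id one has ρ = φ = 1, so equality holds although I_π^- is empty and #I_π^- = 0 ≠ N/2. *)

(* Defs.v *)
From HB Require Import structures.
From mathcomp Require Import all_boot all_order all_algebra all_fingroup.
From mathcomp Require Import all_classical all_reals all_analysis.

Set Implicit Arguments.
Unset Strict Implicit.
Unset Printing Implicit Defensive.

Import Order.TTheory GRing.Theory Num.Theory.
Import numFieldNormedType.Exports.

Local Open Scope classical_set_scope.
Local Open Scope ring_scope.

(* Stripes are indexed from 0: [i : 'I_N] is the stripe numbered [i + 1] in
   1-based notation, so it is the open interval ](i / N), (i + 1) / N[; the
   displacement [i - pi i] does not depend on the choice of origin. *)
Definition stripe (R : realType) (N : nat) (i : 'I_N) : interval R :=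
  `](i%:R / N%:R), (i.+1%:R / N%:R)[.

(* Distinct stripes are disjoint, so at most one [i] can be picked. Points in no
   stripe (in [0, 1]: the N + 1 grid points) are left fixed, by convention. *)
Definition even_shuffle (R : realType) (N : nat) (pi : 'S_N) (x : R) : R :=
  if [pick i : 'I_N | x \in stripe R i] is Some i
  then x - (i%:R - (pi i)%:R) / N%:R
  else x.

Definition copula_of (R : realType) (S : R -> R) (u v : R) : R :=
  fine (lebesgue_measure [set x : R | x \in `[0, u] /\ S x <= v]).

Definition symmetric_copula (R : realType) (C : R -> R -> R) : Prop :=
  forall u v : R, u \in `[0, 1] -> v \in `[0, 1] -> C u v = C v u.

Definition spearman_rho (R : realType) (C : R -> R -> R) : R :=
  12 * Rintegral (lebesgue_measure \x lebesgue_measure)%E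
         (`[0, 1]%classic `*` `[0, 1]%classic) (fun p : R * R => C p.1 p.2) - 3.

Definition spearman_footrule (R : realType) (C : R -> R -> R) : R :=
  6 * Rintegral lebesgue_measure `[0, 1]%classic (fun u : R => C u u) - 2.

Definition shuffle_copula (R : realType) (N : nat) (pi : 'S_N) : R -> R -> R :=
  copula_of (@even_shuffle R N pi).

Definition antiexcedances (N : nat) (pi : 'S_N) : {set 'I_N} :=
  [set i : 'I_N | (pi i < i)%N].

(* Main.v *)
Require Import Defs.
From HB Require Import structures.
From mathcomp Require Import all_boot all_order all_algebra all_fingroup.
From mathcomp Require Import all_classical all_reals all_analysis.
From mathcomp Require Import measurable_realfun ring lra zify.
Set Implicit Arguments.
Unset Strict Implicit.
Unset Printing Implicit Defensive.

Import Order.TTheory GRing.Theory Num.Theory.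
Import numFieldNormedType.Exports.

Local Open Scope ring_scope.

(** Write [d i = (i - pi i) / N] for the displacement of stripe [i]; it has
    mean zero. The theorem is a variance computation for [`|d|].

    A copula integral is an integral over the stripes. By Tonelli, the integral
    of [C (u, v)], the measure of the points [x <= u] with [S x <= v], over the
    unit square is the integral over [x] of the area [(1 - x) * (1 - S x)] of
    the rectangle above [(x, S x)]; on the diagonal the area is replaced by the
    length [1 - max x (S x)]. On stripe [i] the shuffle is [S x = x - d i],
    so both integrals are elementary, and summation over the stripes telescopes
    up to the contribution of [d]:
      [rho = 1 - 6 / N * \sum_i d i ^ 2]   ([spearman_rho_shuffle]),
      [phi = 1 - 3 / N * \sum_i |d i|]     ([spearman_footrule_shuffle]).
    With [m] the mean of the [|d i|], this gives ([rho_phi_gap])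
      [1 - 2 / 3 * (1 - phi) ^ 2 - rho = 6 / N * \sum_i (|d i| - m) ^ 2].
    Hence the inequality, with equality exactly when [|d i|] does not depend
    on [i].

    The equality condition is then read off combinatorially. Symmetry of the
    copula makes [pi] an involution ([symmetric_shuffle_involutive]): at the
    grid points [C] counts the [i < a] with [pi i < b], and the mixed second
    difference of this count is the permutation matrix of [pi]. An
    involution pairs each antiexcedance with an excedance of the same absolute
    displacement. So if [|d|] is constant, either it is zero and [pi] is
    the identity, or there is no fixed point and exactly half of the stripes
    are antiexcedances, all with the same displacement; conversely, if half of
    the stripes are antiexcedances, this pairing reaches every stripe
    ([constant_displacementP]). *)

(** * Tonelli for sets bounded by two graphs *)

Section tonelli.
Local Open Scope classical_set_scope.
Local Open Scope ereal_scope.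

Lemma integral_xsection d1 d2 (T1 : measurableType d1)
    (T2 : measurableType d2) (R : realType)
    (m1 : {sigma_finite_measure set T1 -> \bar R})
    (m2 : {sigma_finite_measure set T2 -> \bar R}) (A : set (T1 * T2)) :
  measurable A ->
  \int[m1]_x m2 (xsection A x) = \int[m2]_y m1 (ysection A y).
Proof.
move=> mA; have := indic_fubini_tonelli m1 m2 mA.
by rewrite indic_fubini_tonelli_FE// indic_fubini_tonelli_GE.
Qed.

(** [strip p] is the set measured by the copula, restricted to one stripe [E] on
    which the shuffle is the translation by [- c]. *)
Section strip.
Context d (T : measurableType d) (R : realType).
Variables (E : set R) (U V : T -> R) (c : R).
Hypotheses (mE : measurable E).
Hypotheses (mU : measurable_fun setT U) (mV : measurable_fun setT V).

Definition strip (p : T) : set R :=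
  [set x | E x /\ (x <= U p /\ x - c <= V p)%R].

Let graph : set (T * measurableTypeR R) := [set q | strip q.1 q.2].

Let measurable_graph : measurable graph.
Proof.
have -> : graph = [set: T] `*` E `&` [set q | (q.2 <= U q.1)%R] `&`
    [set q | (q.2 - c <= V q.1)%R].
  by apply/seteqP; split => q; rewrite /graph /strip /=; tauto.
have m2 : measurable_fun setT
  (snd : T * measurableTypeR R -> measurableTypeR R) by exact: measurable_snd.
apply: measurable_fun_le.
- apply: measurable_fun_le; first exact: measurableX.
    exact: measurable_funTS.
  by apply: measurable_funTS; exact: measurableT_comp.
- by apply: measurable_funTS; exact: measurable_funB.
- by apply: measurable_funTS; exact: measurableT_comp.
Qed.

Lemma measurable_fun_strip :
  measurable_fun setT (fun p => @lebesgue_measure R (strip p)).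
Proof.
have := measurable_fun_xsection (@lebesgue_measure R) measurable_graph.
apply: eq_measurable_fun => p _ /=; rewrite xsectionE.
by congr lebesgue_measure; apply/seteqP; split.
Qed.

(** Cavalieri in the form of Tonelli: both sides measure, under the product
    of [mu] and Lebesgue measure, the set of pairs [(p, x)] with [p] in [D]
    and [x] in [strip p]. *)
Lemma integral_strip (mu : {sigma_finite_measure set T -> \bar R})
    (D : set T) : measurable D ->
  \int[mu]_(p in D) @lebesgue_measure R (strip p) =
  \int[@lebesgue_measure R]_(x in E)
    mu (D `&` [set p | (x <= U p /\ x - c <= V p)%R]).
Proof.
move=> mD; pose A := graph `&` (D `*` [set: measurableTypeR R]).
have mA : measurable A by apply: measurableI => //; exact: measurableX.
have eqA := integral_xsection mu (@lebesgue_measure R) mA.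
rewrite integral_mkcond [in RHS]integral_mkcond.
transitivity (\int[mu]_p (@lebesgue_measure R (xsection A p))).
  apply: eq_integral => p _; rewrite patchE xsectionE.
  case: ifPn => [|/negP]; rewrite inE => pD.
    congr lebesgue_measure; apply/seteqP; split => x;
      by rewrite /A /graph /=; tauto.
  rewrite (_ : _ @^-1` _ = set0) ?measure0// -subset0 => x /=.
  by rewrite /A /=; tauto.
rewrite eqA; apply: eq_integral => x _; rewrite patchE ysectionE.
case: ifPn => [|/negP]; rewrite inE => xE.
  congr (mu _); apply/seteqP; split => p;
    by rewrite /A /graph /strip /=; tauto.
rewrite (_ : _ @^-1` _ = set0) ?measure0// -subset0 => p /=.
by rewrite /A /graph /strip /=; tauto.
Qed.

End strip.
End tonelli.

Section plane_measure.
Local Open Scope classical_set_scope.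
Local Open Scope ereal_scope.
Variable R : realType.

(** The name carries the sigma-finiteness of two-dimensional Lebesgue measure,
    so that the measure can be the outer one in [integral_strip]. *)
Definition plane_measure :
    set (measurableTypeR R * measurableTypeR R) -> \bar R :=
  (@lebesgue_measure R \x @lebesgue_measure R).

HB.instance Definition _ := Measure.on plane_measure.

Lemma plane_measure_sigma_finite : sigma_finite setT plane_measure.
Proof.
have /sigma_finiteP[F [TF ndF Foo]] := sigma_finiteT (@lebesgue_measure R).
exists (fun n => F n `*` F n).
  rewrite -setXTT TF predeqE => -[x y]; split.
    move=> [/= [n _ Fnx] [k _ Fky]]; exists (maxn n k) => //; split.
    - by move: x Fnx; exact/subsetPset/ndF/leq_maxl.
    - by move: y Fky; exact/subsetPset/ndF/leq_maxr.
  by move=> [n _ []/= ? ?]; split; exists n.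
move=> k; have [mF Fk] := Foo k.
split; first exact: measurableX.
by rewrite /plane_measure product_measure1E// lte_mul_pinfty// ge0_fin_numE.
Qed.

HB.instance Definition _ := @Measure_isSigmaFinite.Build _ _ R plane_measure
  plane_measure_sigma_finite.

End plane_measure.

(** * Integrals of polynomials over an open interval *)

Section polynomial_integrals.
Local Open Scope classical_set_scope.
Local Open Scope ring_scope.

Lemma integral_deriv_horner (R : realType) (p : {poly R}) (a b : R) : a < b ->
  (\int[lebesgue_measure]_(x in `]a, b[) (p^`().[x])%:E
   = (p.[b] - p.[a])%:E)%E.
Proof.
move=> ab.
have cp (q : {poly R}) : continuous (horner q).
  move=> x; apply: differentiable_continuous; apply/derivable1_diffP.
  exact: derivable_horner.
rewrite -(@integral_itv_bndoo _ _ _ _ true false).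
  rewrite (@continuous_FTC2 _ _ (horner p))//.
  - exact: continuous_subspaceT.
  - split=> [x _||]; first exact: derivable_horner.
    + by apply: cvg_at_right_filter; exact: cp.
    + by apply: cvg_at_left_filter; exact: cp.
  - by move=> x _; rewrite -derivE.
apply/measurable_EFinP; apply: measurable_funTS.
exact: continuous_measurable_fun.
Qed.

Lemma integral_itv_oo_quadratic (R : realType) (a b e : R) : a < b ->
  (\int[lebesgue_measure]_(x in `]a, b[) ((1 - x) * (e - x))%:E
   = (e * (b - a) - (1 + e) / 2 * (b ^+ 2 - a ^+ 2) +
      3^-1 * (b ^+ 3 - a ^+ 3))%:E)%E.
Proof.
move=> ab.
pose p : {poly R} := e *: 'X - ((1 + e) / 2) *: 'X^2 + 3^-1 *: 'X^3.
apply: etrans (etrans (integral_deriv_horner p ab) _).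
  apply: eq_integral => x _; congr EFin.
  by rewrite /p !poly.derivE !hornerE /= ?hornerE /=; field.
by congr (_%:E); rewrite /p !hornerE /=; field.
Qed.

Lemma integral_itv_oo_affine (R : realType) (a b e : R) : a < b ->
  (\int[lebesgue_measure]_(x in `]a, b[) (e - x)%:E
   = (e * (b - a) - (b ^+ 2 - a ^+ 2) / 2)%:E)%E.
Proof.
move=> ab.
pose p : {poly R} := e *: 'X - 2^-1 *: 'X^2.
apply: etrans (etrans (integral_deriv_horner p ab) _).
  apply: eq_integral => x _; congr EFin.
  by rewrite /p !poly.derivE !hornerE /= ?hornerE /=; field.
by congr (_%:E); rewrite /p !hornerE /=; field.
Qed.

End polynomial_integrals.

(** * The copula of a shuffle as a sum over stripes *)

Section shuffle.
Local Open Scope classical_set_scope.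
Local Open Scope ring_scope.
Variables (R : realType) (N : nat) (pi : 'S_N).
Hypothesis N0 : (0 < N)%N.
Local Notation h := (N%:R^-1 : R).
Local Notation C := (@shuffle_copula R N pi).

Let N0' : 0 < N%:R :> R. Proof. by rewrite ltr0n. Qed.
Let h0 : 0 < h. Proof. by rewrite invr_gt0. Qed.
Let hN : h * N%:R = 1. Proof. by rewrite mulVf ?gt_eqF. Qed.

Definition displacement (i : 'I_N) : R := (i%:R - (pi i)%:R) / N%:R.
Local Notation d := displacement.

Lemma mem_stripeE (i : 'I_N) (x : R) :
  (x \in stripe R i) = (i%:R < x * N%:R < i.+1%:R).
Proof. by rewrite in_itv /= ltr_pdivrMr// ltr_pdivlMr. Qed.

Lemma stripe_inj (i j : 'I_N) (x : R) :
  x \in stripe R i -> x \in stripe R j -> i = j.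
Proof.
rewrite !mem_stripeE => /andP[i1 i2] /andP[j1 j2]; apply/val_inj/eqP => /=.
move: (lt_trans i1 j2) (lt_trans j1 i2); rewrite !ltr_nat !ltnS => ij ji.
by rewrite eqn_leq ij.
Qed.

Lemma even_shuffle_stripe (i : 'I_N) (x : R) :
  x \in stripe R i -> even_shuffle pi x = x - d i.
Proof.
rewrite /even_shuffle => xi; case: pickP => [j xj|/(_ i)].
  by rewrite (stripe_inj xi xj).
by rewrite xi.
Qed.

Lemma stripe_or_grid (x : R) : x \in `[0, 1] ->
  (exists i : 'I_N, x \in stripe R i) \/
  (exists i : 'I_N.+1, x = i%:R / N%:R).
Proof.
rewrite in_itv /= => /andP[x0 x1].
have y0 : 0 <= x * N%:R by rewrite mulr_ge0.
have yN : x * N%:R <= N%:R by rewrite ler_piMl.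
have /andP[k1 k2] := truncn_itv y0.
set k := Num.Def.trunc _ in k1 k2.
have kN : (k <= N)%N by rewrite -(ler_nat R) (le_trans k1).
have [xk|xk] := eqVneq (x * N%:R) k%:R.
  right; exists (Ordinal (kN : (k < N.+1)%N)).
  by rewrite /= -xk mulfK// gt_eqF.
left; have kx : k%:R < x * N%:R by rewrite lt_neqAle eq_sym xk.
have kN' : (k < N)%N by rewrite -(ltr_nat R) (lt_le_trans kx).
by exists (Ordinal kN'); rewrite mem_stripeE /= kx.
Qed.

Definition shuffle_piece (i : 'I_N) (u v : R) : set R :=
  [set x | x \in stripe R i /\ (x <= u /\ x - d i <= v)].

Lemma shuffle_pieceE i u v : shuffle_piece i u v =
  [set` stripe R i] `&`
  (`]-oo, u]%classic `&` `]-oo, v + d i]%classic).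
Proof.
apply/seteqP; split => x; rewrite /shuffle_piece /= !in_itv /= lerBlDr;
  by move=> [? []].
Qed.

Lemma measurable_shuffle_piece i u v : measurable (shuffle_piece i u v).
Proof. by rewrite shuffle_pieceE; do ?apply: measurableI. Qed.

Lemma lebesgue_measure_stripe (i : 'I_N) :
  lebesgue_measure [set` stripe R i] = (N%:R^-1)%:E.
Proof.
rewrite lebesgue_measure_itv /= lte_fin ltr_pM2r ?invr_gt0// ltr_nat ltnSn.
by rewrite -EFinB -mulrBl -natrB// subSnn mul1r.
Qed.

(** The points of [0, 1] that lie in no stripe are finitely many, hence
    negligible, and on each stripe the shuffle is a translation. *)
Lemma shuffle_copulaE (u v : R) : u \in `[0, 1]%R ->
  (C u v)%:E =
  (\sum_(i < N) lebesgue_measure (shuffle_piece i u v))%E.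
Proof.
move=> u01.
have u1 : u <= 1 by move: u01; rewrite in_itv /= => /andP[].
set A := [set x | x \in `[0, u]%R /\ even_shuffle pi x <= v].
pose P := \big[setU/set0]_(i < N) shuffle_piece i u v.
pose G := A `&` (range (fun i : 'I_N.+1 => i%:R / N%:R : R)).
have stripe01 (i : 'I_N) x : x \in stripe R i -> 0 <= x.
  rewrite in_itv /= => /andP[ix _]; apply/ltW/(le_lt_trans _ ix).
  by rewrite divr_ge0.
have AE : A = P `|` G.
  rewrite /P -bigcup_seq; apply/seteqP; split => x.
    move=> Ax; have [/= xu Sv] := Ax.
    have /stripe_or_grid[[i xi]|[i xi]] : x \in `[0, 1]%R.
    - by move: xu; rewrite !in_itv /= => /andP[-> /le_trans ->].
    - left; exists i; first by rewrite /= mem_index_enum.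
      split=> //; rewrite -(even_shuffle_stripe xi); split=> //.
      by move: xu; rewrite in_itv /= => /andP[].
    - by right; split => //; exists i.
  move=> [[i _ [xi [xu xv]]]|[]//].
  by rewrite /A/= (even_shuffle_stripe xi) in_itv/= (stripe01 _ _ xi).
have G0 : countable G.
  apply: finite_set_countable; apply: (@sub_finite_set _ _ _ (@subIsetr _ _ _)).
  exact: finite_image.
have -> : C u v = fine (lebesgue_measure A) by [].
have EA : lebesgue_measure A =
    (\sum_(i < N) lebesgue_measure (shuffle_piece i u v))%E.
  rewrite AE measureU0//.
  - rewrite /P measure_bigsetU_ord//.
      by move=> i; exact: measurable_shuffle_piece.
    move=> i j _ _ [x [[xi _] [xj _]]]; exact: stripe_inj xi xj.
  - by apply: bigsetU_measurable => i _; exact: measurable_shuffle_piece.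
  - exact: countable_measurable.
  - exact: countable_lebesgue_measure0.
rewrite EA fineK// sum_fin_num; apply/allP => _ /mapP[i _ ->] /=.
rewrite ge0_fin_numE// (@le_lt_trans _ _ (N%:R^-1)%:E)// ?ltry//.
rewrite -(lebesgue_measure_stripe i) le_measure ?inE//.
- exact: measurable_shuffle_piece.
- by move=> x [].
Qed.

(** * Spearman's rho and footrule of a shuffle *)

(** Tonelli on each stripe. Both coefficients are instances: [U] and [V] are the
    two projections for rho, and the identity for the footrule. *)
Lemma integral_shuffle_copula e (T : measurableType e)
    (mu : {sigma_finite_measure set T -> \bar R}) (D : set T) (U V : T -> R) :
  measurable D -> measurable_fun setT U -> measurable_fun setT V ->
  (forall p, D p -> U p \in `[0, 1]%R) ->
  (\int[mu]_(p in D) (C (U p) (V p))%:E =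
   \sum_(i < N) \int[lebesgue_measure]_(x in [set` stripe R i])
      mu (D `&` [set p | (x <= U p /\ x - d i <= V p)%R]))%E.
Proof.
move=> mD mU mV U01.
transitivity (\int[mu]_(p in D) \sum_(i < N)
    lebesgue_measure (shuffle_piece i (U p) (V p)))%E.
  by apply: eq_integral => p /[!inE] Dp; rewrite shuffle_copulaE// U01.
rewrite ge0_integral_sum//; last first.
  move=> i; apply: measurable_funTS.
  exact: (@measurable_fun_strip _ _ _ [set` stripe R i]).
apply: eq_bigr => i _.
exact: (@integral_strip _ _ _ [set` stripe R i]).
Qed.

Lemma stripe_sub01 (i : 'I_N) (x : R) :
  x \in stripe R i -> 0 <= x <= 1 /\ 0 <= x - d i <= 1.
Proof.
rewrite mem_stripeE => /andP[ix xi].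
have xE : x = x * N%:R * h by rewrite mulfK// gt_eqF.
have diE : x - d i = (x * N%:R - i%:R + (pi i)%:R) * h.
  by rewrite /d {1}xE; ring.
have bound (y : R) : 0 <= y <= N%:R -> 0 <= y * h <= 1.
  move=> /andP[y0 yN]; rewrite mulr_ge0 ?(ltW h0)//=.
  by rewrite -(@ler_pM2r _ N%:R)// -mulrA hN mulr1 mul1r.
have iN (j : 'I_N) : j%:R + 1 <= N%:R :> R by rewrite natr1 ler_nat.
have := iN i; have := iN (pi i); rewrite -natr1 in xi.
have i0 : 0 <= i%:R :> R by [].
have p0 : 0 <= (pi i)%:R :> R by [].
move=> Hp Hi; split; first by rewrite {1 2}xE bound//; lra.
by rewrite diE bound//; lra.
Qed.

Lemma lebesgue_measure_above (y : R) : y <= 1 ->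
  lebesgue_measure [set` `[y, 1]%R] = (1 - y)%:E.
Proof.
rewrite le_eqVlt => /orP[/eqP->|y1].
  by rewrite set_itv1 lebesgue_measure_set1 subrr.
by rewrite lebesgue_measure_itv /= lte_fin y1 -EFinB.
Qed.

Lemma plane_measure_above (i : 'I_N) (x : R) : x \in stripe R i ->
  plane_measure ((`[0%R, 1%R]%classic `*` `[0%R, 1%R]%classic) `&`
    [set p : R * R | x <= p.1 /\ x - d i <= p.2]) =
  ((1 - x) * (1 + d i - x))%:E.
Proof.
move=> /stripe_sub01[/andP[x0 x1] /andP[y0 y1]].
have -> : (`[0%R, 1%R]%classic `*` `[0%R, 1%R]%classic) `&`
    [set p : R * R | x <= p.1 /\ x - d i <= p.2] =
    [set` `[x, 1]%R] `*` [set` `[x - d i, 1]%R].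
  apply/seteqP; split => [[u v]|[u v]] /=; rewrite !in_itv /=.
    by move=> [[/andP[_ ->] /andP[_ ->]] [-> ->]].
  move=> [/andP[xu ->] /andP[xv ->]].
  by rewrite xu xv (le_trans x0)// (le_trans y0).
rewrite /plane_measure product_measure1E//=.
rewrite !lebesgue_measure_above// -EFinM.
by congr EFin; ring.
Qed.

(** The set is the interval from [max x (x - d i) = x + max 0 (- d i)] to 1. *)
Lemma lebesgue_measure_diag_above (i : 'I_N) (x : R) : x \in stripe R i ->
  lebesgue_measure (`[0%R, 1%R]%classic `&`
    [set u : R | (x <= u /\ x - d i <= u)%R]) =
  (1 - Num.max 0 (- d i) - x)%:E.
Proof.
move=> /stripe_sub01[/andP[x0 x1] /andP[y0 y1]].
pose m := Num.max x (x - d i).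
have mE : m = x + Num.max 0 (- d i) by rewrite addr_maxr addr0.
have -> : `[0%R, 1%R]%classic `&` [set u : R | x <= u /\ x - d i <= u] =
    [set` `[m, 1]%R].
  apply/seteqP; split => u /=; rewrite !in_itv /= ge_max.
    by move=> [/andP[_ ->] [-> ->]].
  by move=> /andP[/andP[xu yu] ->]; rewrite xu yu (le_trans x0).
rewrite lebesgue_measure_above ?ge_max ?x1//.
by congr EFin; rewrite mE; ring.
Qed.

Lemma sum_telescope_stripe (f : R -> R) :
  \sum_(i < N) (f (i.+1%:R * h) - f (i%:R * h)) = f 1 - f 0.
Proof.
rewrite -(big_mkord xpredT (fun i => f (i.+1%:R * h) - f (i%:R * h))).
rewrite (telescope_sumr (fun i => f (i%:R * h)))//.
by rewrite mulfV ?gt_eqF// mul0r.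
Qed.

(** [pi] permutes the stripes. *)
Lemma sum_displacement : \sum_(i < N) d i = 0.
Proof.
under eq_bigr => i _ do rewrite /d mulrBl.
rewrite sumrB [X in _ - X](_ : _ = \sum_(i < N) i%:R * h) ?subrr//.
by rewrite [RHS](reindex_inj (@perm_inj _ pi)).
Qed.

(** Expand [(pi i / N) ^ 2 = (i / N - d i) ^ 2]: both squares have the same sum
    over [i], since [pi] permutes the stripes. *)
Lemma sum_pos_displacement :
  \sum_(i < N) (i%:R * h) * d i = 2^-1 * \sum_(i < N) d i ^+ 2.
Proof.
have e0 : \sum_(i < N) (i%:R * h) ^+ 2 = \sum_(i < N) ((pi i)%:R * h) ^+ 2.
  by rewrite [LHS](reindex_inj (@perm_inj _ pi)).
apply/eqP; rewrite -subr_eq0; apply/eqP.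
have -> : \sum_(i < N) (i%:R * h) * d i - 2^-1 * \sum_(i < N) d i ^+ 2 =
    2^-1 * (\sum_(i < N) (i%:R * h) ^+ 2 - \sum_(i < N) ((pi i)%:R * h) ^+ 2).
  rewrite -sumrB !mulr_sumr -sumrB; apply: eq_bigr => i _.
  by rewrite /d; field; rewrite gt_eqF.
by rewrite e0 subrr mulr0.
Qed.

Lemma spearman_rho_shuffle :
  spearman_rho C = 1 - 6 * h * \sum_(i < N) d i ^+ 2.
Proof.
pose D : set (measurableTypeR R * measurableTypeR R) :=
  `[0%R, 1%R]%classic `*` `[0%R, 1%R]%classic.
have mD : measurable D by exact: measurableX.
have U01 (p : R * R) : D p -> p.1 \in `[0, 1]%R by move=> [].
(* [f] is a primitive of [(1 - x) ^ 2], the integrand of a stripe that is not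
   displaced; it is the part that telescopes. *)
pose f (x : R) := x - x ^+ 2 + 3^-1 * x ^+ 3.
have Fi (i : 'I_N) : (\int[lebesgue_measure]_(x in [set` stripe R i])
      plane_measure (D `&` [set p | (x <= p.1 /\ x - d i <= p.2)%R]) =
      (f (i.+1%:R * h) - f (i%:R * h) +
       (h - h ^+ 2 / 2) * d i - h * (i%:R * h * d i))%:E)%E.
  transitivity (\int[lebesgue_measure]_(x in [set` stripe R i])
      ((1 - x) * (1 + d i - x))%:E)%E.
    by apply: eq_integral => x /[!inE] xi; rewrite plane_measure_above.
  rewrite integral_itv_oo_quadratic ?ltr_pM2r ?ltr_nat//.
  by congr EFin; rewrite /f -natr1; field; rewrite gt_eqF.
have -> : spearman_rho C = 12 *
    fine (\int[@plane_measure R]_(p in D) (C p.1 p.2)%:E)%E - 3 by [].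
rewrite (@integral_shuffle_copula _ _ (@plane_measure R) D fst snd)//.
under eq_bigr => i _ do rewrite Fi.
rewrite sumEFin /= big_split /= big_split /= sumrN -!mulr_sumr.
rewrite sum_displacement sum_pos_displacement sum_telescope_stripe /f.
by field; rewrite gt_eqF.
Qed.

Lemma spearman_footrule_shuffle :
  spearman_footrule C = 1 - 3 * h * \sum_(i < N) `|d i|.
Proof.
(* Likewise a primitive of [1 - x]. *)
pose f (x : R) := x - x ^+ 2 / 2.
have Fi (i : 'I_N) : (\int[lebesgue_measure]_(x in [set` stripe R i])
      lebesgue_measure (`[0%R, 1%R]%classic `&`
         [set u : R | (x <= u /\ x - d i <= u)%R]) =
      (f (i.+1%:R * h) - f (i%:R * h) +
       h / 2 * d i - h / 2 * `|d i|)%:E)%E.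
  transitivity (\int[lebesgue_measure]_(x in [set` stripe R i])
      (1 - Num.max 0 (- d i) - x)%:E)%E.
    by apply: eq_integral => x /[!inE] xi; rewrite lebesgue_measure_diag_above.
  rewrite integral_itv_oo_affine ?ltr_pM2r ?ltr_nat//.
  have -> : Num.max 0 (- d i) = (`|d i| - d i) / 2.
    case: (lerP 0 (d i)) => di.
      by rewrite max_l ?oppr_le0// ger0_norm// subrr mul0r.
    by rewrite max_r ?oppr_ge0 ?(ltW di)// ltr0_norm//; field.
  by congr EFin; rewrite /f -natr1; field; rewrite gt_eqF.
have -> : spearman_footrule C = 6 *
    fine (\int[lebesgue_measure]_(u in `[0%R, 1%R]) (C u u)%:E)%E - 2 by [].
rewrite (@integral_shuffle_copula _ _ lebesgue_measure `[0%R, 1%R] id id)//.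
under eq_bigr => i _ do rewrite Fi.
rewrite sumEFin /= big_split /= big_split /= sumrN -!mulr_sumr.
rewrite sum_displacement sum_telescope_stripe /f.
by field; rewrite gt_eqF.
Qed.

(** * Symmetric shuffles *)

(** At a grid point a stripe lies entirely inside or entirely outside the set
    measured by the copula. *)
Lemma shuffle_copula_grid (a b : nat) : (a <= N)%N ->
  C (a%:R / N%:R) (b%:R / N%:R) =
  h * (\sum_(i < N) ((i < a) * (pi i < b))%N)%:R.
Proof.
move=> aN; apply: EFin_inj; rewrite shuffle_copulaE; last first.
  by rewrite in_itv /= divr_ge0//= ler_pdivrMr// mul1r ler_nat.
rewrite natr_sum mulr_sumr -sumEFin; apply: eq_bigr => i _.
have below (k c : nat) (y : R) : (k < c)%N -> y < k.+1%:R * h -> y <= c%:R * h.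
  move=> kc /ltW /le_trans; apply.
  by rewrite ler_pM2r// ler_nat.
have above (k c : nat) (y : R) : (c <= k)%N -> k%:R * h < y -> c%:R * h < y.
  move=> ck; apply: le_lt_trans.
  by rewrite ler_pM2r// ler_nat.
have shift (x : R) : x - d i = x - i%:R * h + (pi i)%:R * h.
  by rewrite /d; ring.
have [ia|ia] := ltnP i a; last first.
  rewrite mul0n mulr0 [shuffle_piece _ _ _](_ : _ = set0) ?measure0//.
  rewrite -subset0 => x [] /=; rewrite in_itv /= => /andP[ix _] [xa _].
  by have := above _ _ _ ia ix; rewrite ltNge xa.
have [ib|ib] := ltnP (pi i) b; last first.
  rewrite muln0 mulr0 [shuffle_piece _ _ _](_ : _ = set0) ?measure0//.
  rewrite -subset0 => x [] /=; rewrite in_itv /= => /andP[ix _] [_ xb].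
  suff /(above _ _ _ ib) : (pi i)%:R * h < x - d i by rewrite ltNge xb.
  by rewrite shift; lra.
rewrite mulr1 -(lebesgue_measure_stripe i).
congr lebesgue_measure; apply/seteqP; split => x; first by case.
move=> /= xi; split => //; move: (xi); rewrite in_itv /= => /andP[ix xi'].
split; first exact: below ia xi'.
apply: below ib _; rewrite shift; move: xi'.
by rewrite -!natr1 !mulrDl; lra.
Qed.

(** The counts [n a b] of the stripes with [i < a] and [pi i < b] are the values
    of [N * C] at grid points. Their mixed second difference at [(a, b)]
    is 1 if [pi a = b] and 0 otherwise, so symmetry of [C] says that the
    permutation matrix of [pi] is symmetric. *)
Lemma symmetric_shuffle_involutive : symmetric_copula C -> involutive pi.
Proof.
move=> symC.
pose n (a b : nat) := (\sum_(i < N) ((i < a) * (pi i < b))%N)%N.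
have nsym (a b : nat) : (a <= N)%N -> (b <= N)%N -> n a b = n b a.
  move=> aN bN.
  have grid01 (c : nat) : (c <= N)%N -> (c%:R / N%:R : R) \in `[0, 1]%R.
    by move=> cN; rewrite in_itv /= divr_ge0//= ler_pdivrMr// mul1r ler_nat.
  have := symC _ _ (grid01 a aN) (grid01 b bN).
  rewrite !shuffle_copula_grid// => /(mulfI (lt0r_neq0 h0)) /eqP.
  by rewrite eqr_nat => /eqP.
have cell (a b : 'I_N) :
    (n a.+1 b.+1 + n a b = n a b.+1 + n a.+1 b + (pi a == b))%N.
  have -> : (pi a == b)%N = (\sum_(i < N) ((i == a) * (pi i == b))%N)%N :> nat.
    rewrite (bigD1 a)//= eqxx mul1n big1 ?addn0// => i /negbTE ->.
    by rewrite mul0n.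
  rewrite /n -!big_split /=; apply: eq_bigr => i _.
  rewrite !ltnS -!val_eqE /=.
  by case: (ltngtP i a); case: (ltngtP (pi i) b).
move=> a; apply/eqP.
have := cell (pi a) a; have := cell a (pi a).
rewrite (nsym a.+1 (pi a).+1)// (nsym a (pi a)) ?(ltnW (ltn_ord _))//.
rewrite (nsym a (pi a).+1) ?(ltnW (ltn_ord _))//.
rewrite (nsym a.+1 (pi a)) ?(ltnW (ltn_ord _))// eqxx.
by case: eqP => //; lia.
Qed.

(** * The inequality and its equality case *)

(** With both coefficients expressed by the displacements, the gap in the
    inequality is the variance of [|d|] up to a constant factor. *)
Lemma rho_phi_gap (m := h * \sum_(i < N) `|d i|) :
  1 - 2 / 3 * (1 - spearman_footrule C) ^+ 2 - spearman_rho C =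
  6 * h * \sum_(i < N) (`|d i| - m) ^+ 2.
Proof.
rewrite spearman_rho_shuffle spearman_footrule_shuffle.
have -> : \sum_(i < N) (`|d i| - m) ^+ 2 =
    \sum_(i < N) d i ^+ 2 - 2 * m * (\sum_(i < N) `|d i|) + N%:R * m ^+ 2.
  rewrite mulr_sumr -sumrB.
  rewrite (_ : N%:R * m ^+ 2 = \sum_(i < N) m ^+ 2); last first.
    by rewrite sumr_const card_ord mulr_natl.
  rewrite -big_split; apply: eq_bigr => i _ /=.
  by rewrite sqrrB real_normK ?num_real//; ring.
by rewrite /m; field; rewrite gt_eqF.
Qed.

Lemma rho_phi_le :
  spearman_rho C <= 1 - 2 / 3 * (1 - spearman_footrule C) ^+ 2.
Proof.
rewrite -subr_ge0 rho_phi_gap mulr_ge0 ?mulr_ge0 ?(ltW h0)//.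
by apply: sumr_ge0 => i _; exact: sqr_ge0.
Qed.

Lemma rho_phi_eqP :
  spearman_rho C = 1 - 2 / 3 * (1 - spearman_footrule C) ^+ 2 <->
  (forall i j, `|d i| = `|d j|).
Proof.
pose m := h * \sum_(i < N) `|d i|.
split=> [/esym/eqP|dC].
  rewrite -subr_eq0 rho_phi_gap mulf_eq0 (gt_eqF (_ : 0 < 6 * h)) ?mulr_gt0//=.
  rewrite psumr_eq0 => [|i _]; last exact: sqr_ge0.
  have dm i : (`|d i| - m) ^+ 2 == 0 -> `|d i| = m.
    by rewrite sqrf_eq0 subr_eq0 => /eqP.
  move=> /allP dE i j.
  by rewrite (dm i (dE i (mem_index_enum i))) (dm j (dE j (mem_index_enum j))).
apply/esym/eqP; rewrite -subr_eq0 rho_phi_gap big1 ?mulr0// => i _.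
rewrite (eq_bigr (fun=> `|d i|)) => [|j _]; last exact: dC.
rewrite sumr_const card_ord -(mulr_natl `|d i|) mulrA mulVf ?gt_eqF//.
by rewrite mul1r subrr expr0n.
Qed.

Lemma displacement_norm_eq (i j : 'I_N) : `|d i| = `|d j| <->
  `|i%:Z - (pi i)%:Z| = `|j%:Z - (pi j)%:Z|.
Proof.
have dE k : `|d k| = (`|k%:Z - (pi k)%:Z|)%:~R * h.
  by rewrite /d normrM (gtr0_norm h0) intr_norm rmorphB.
rewrite !dE; split=> [/(mulIf (lt0r_neq0 h0)) /intr_inj//|-> //].
Qed.

End shuffle.

(** * The equality case for involutions *)

Section antiexcedances.
Variables (N : nat) (pi : 'S_N).
Hypothesis piK : involutive pi.

Lemma antiexcedancesE (i : 'I_N) : (i \in antiexcedances pi) = (pi i < i)%N.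
Proof. by rewrite inE. Qed.

(** An involution without fixed points exchanges antiexcedances and excedances,
    which gives the forward direction. Conversely, the image of the
    antiexcedances under [pi] consists of excedances; if half of the indices are
    antiexcedances, it fills the complement, so every displacement is, up to
    sign, that of an antiexcedance. *)
Lemma constant_displacementP :
  (forall i j : 'I_N, `|i%:Z - (pi i)%:Z| = `|j%:Z - (pi j)%:Z|) <->
  pi = 1%g \/
  {in antiexcedances pi &, forall i j : 'I_N,
      (pi i)%:Z - i%:Z = (pi j)%:Z - j%:Z} /\
  (#|antiexcedances pi| * 2 = N)%N.
Proof.
set A := antiexcedances pi.
have card_image : #|pi @: A| = #|A|.
  by rewrite card_imset//; exact: perm_inj.
have sub_image : pi @: A \subset ~: A.
  apply/fintype.subsetP => _ /imsetP[i iA ->]; move: iA.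
  by rewrite finset.in_setC !antiexcedancesE piK -leqNgt => /ltnW.
have cardA : (#|A| + #|~: A| = N)%N by rewrite cardsC card_ord.
split=> [dC|[->|[cA cardN]]].
- have [->|pi1] := eqVneq pi 1%g; [by left|right].
  have nofix i : pi i != i.
    apply: contra pi1 => /eqP pii; apply/eqP/permP => j; rewrite perm1.
    have := dC j i; rewrite pii subrr normr0 => /normr0_eq0/eqP.
    by rewrite subr_eq0 => /eqP[] /val_inj.
  split.
    by move=> i j; rewrite !antiexcedancesE; have := dC i j; lia.
  have -> : (#|A| * 2 = #|A| + #|A|)%N by lia.
  rewrite -{2}card_image -[RHS]cardA; congr (_ + #|pred_of_set _|)%N.
  apply/eqP; rewrite finset.eqEsubset sub_image/=; apply/fintype.subsetP => i.
  rewrite finset.in_setC antiexcedancesE -leqNgt => ipi.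
  apply/imsetP; exists (pi i) => //.
  by rewrite antiexcedancesE piK ltn_neqAle ipi andbT val_eqE eq_sym.
- by move=> i j; rewrite !perm1 !subrr.
have image_eq : pi @: A = ~: A.
  by apply/eqP; rewrite eqEcard sub_image card_image; lia.
have to_anti (i : 'I_N) : exists2 j, j \in A &
    `|i%:Z - (pi i)%:Z| = `|j%:Z - (pi j)%:Z|.
  have [iA|iA] := boolP (i \in A); first by exists i.
  have /imsetP[j jA ->] : i \in pi @: A by rewrite image_eq finset.in_setC.
  by exists j => //; rewrite piK distrC.
move=> i j; have [k kA ->] := to_anti i; have [l lA ->] := to_anti j.
by rewrite distrC (cA k l)// distrC.
Qed.

End antiexcedances.

Theorem theorem3p3 (R : realType) (N : nat) (hN : (0 < N)%N) (pi : 'S_N)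
    (hsym : symmetric_copula (@shuffle_copula R N pi)) :
  let rho := spearman_rho (@shuffle_copula R N pi) in
  let phi := spearman_footrule (@shuffle_copula R N pi) in
  rho <= 1 - 2 / 3 * (1 - phi) ^+ 2 /\
  (rho = 1 - 2 / 3 * (1 - phi) ^+ 2 <->
   pi = 1%g \/
   ({in antiexcedances pi &, forall i j : 'I_N,
       (pi i)%:Z - i%:Z = (pi j)%:Z - j%:Z} /\
    #|antiexcedances pi|%:R = N%:R / 2 :> R)).
Proof.
move=> rho phi; split; first exact: rho_phi_le.
have piK := symmetric_shuffle_involutive hN hsym.
have half : #|antiexcedances pi|%:R = N%:R / 2 :> R <->
    (#|antiexcedances pi| * 2 = N)%N.
  split=> [cardE|cardE]; last by rewrite -[in RHS]cardE natrM mulfK.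
  by apply/eqP; rewrite -(eqr_nat R) natrM cardE divfK.
have gapP := rho_phi_eqP R pi hN; have constP := constant_displacementP piK.
have normP := @displacement_norm_eq R N pi hN.
by rewrite half -constP gapP; split=> E i j; apply/normP.
Qed.
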